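(* Let $G$ be a topological group and let $\phi: G \rightarrow H$ be a t.d.l.c. completion map. Then there is a $G$-stable local filter $\mathcal{S}$ and a unique topological group isomorphism $\psi: \hat{G}_{\mathcal{S}} \rightarrow H$ such that $\phi = \psi \circ \beta_{(G,\mathcal{S})}$.
   Context: Topological groups are Hausdorff. A t.d.l.c. group is a totally disconnected, locally compact (Hausdorff) topological group. For a topological group $G$, a (t.d.l.c.) completion map is a continuous homomorphism $\phi:G\rightarrow H$ with dense image such that $H$ is a t.d.l.c. group. Two subgroups $U,V$ of a group are commensurate if $U\cap V$ has finite index in both $U$ and $V$. A $G$-stable local filter is a set $\mathcal{S}$ of open subgroups of $G$ such that: (a) $\mathcal{S}$ is non-empty; (b) any two elements of $\mathcal{S}$ are commensurate; (c) given a finite subset $\{V_1,\dots,V_n\}$ of $\mathcal{S}$, $\bigcap_{i=1}^n V_i\in\mathcal{S}$, and given $V\le W\le G$ with $|W:V|$ finite, $V\in\mathcal{S}$ implies $W\in\mathcal{S}$; (d) if $V\in\mathcal{S}$ and $g\in G$ then $gVg^{-1}\in\mathcal{S}$. Completion with respect to $\mathcal{S}$. A (right) $\mathcal{S}$-Cauchy filter in $G$ is a filter $f$ of subsets of $G$ such that for every $V\in\mathcal{S}$ there is exactly one right coset $Vg$ of $V$ in $G$ with $Vg\in f$, and every element of $f$ contains a right coset of some element of $\mathcal{S}$. The set $\hat{G}_{\mathcal{S}}$ consists of all $\mathcal{S}$-Cauchy filters in $G$, with the topology of the uniformity whose entourages are $E_U=\{(f,f')\mid \exists g\in G: Ug\in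 f\cap f'\}$ for $U\in\mathcal{S}$. For $f,f'\in\hat{G}_{\mathcal{S}}$, the product $ff'$ is the $\mathcal{S}$-Cauchy filter generated by the sets $AB$ with $A\in f$, $B\in f'$; with this multiplication $\hat{G}_{\mathcal{S}}$ is a topological group. The map $\beta_{(G,\mathcal{S})}:G\rightarrow\hat{G}_{\mathcal{S}}$ sends $g$ to the filter $f_g$ generated by $\{Vg\mid V\in\mathcal{S}\}$; it is a continuous homomorphism with dense image.
   Formalization: In the definition of an S-Cauchy filter f, every element of f is required to contain a right coset of some element of S that itself belongs to f; without this the completion need not be Hausdorff (e.g. for the identity of Z_p) and the claim fails. *)

(* Defs.v *)
From HB Require Import structures.
From mathcomp Require Import all_boot.
From mathcomp Require Import all_classical.
From mathcomp Require Import topology.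

Set Implicit Arguments.
Unset Strict Implicit.
Unset Printing Implicit Defensive.

Local Open Scope classical_set_scope.
Local Open Scope group_scope.

(* Topological groups, written multiplicatively and Hausdorff by convention. *)
HB.mixin Record isTopGroup G & Group G & Topological G := {
  mulg_continuous : continuous (fun p : G * G => p.1 * p.2);
  invg_continuous : continuous (fun x : G => x^-1);
  topgroup_hausdorff : hausdorff_space G }.

#[short(type="topGroupType")]
HB.structure Definition TopGroup :=
  {G of Group G & Topological G & isTopGroup G}.

Definition tdlc (G : topGroupType) :=
  totally_disconnected [set: G] /\ locally_compact [set: G].

Definition tdlc_completion_map (G H : topGroupType) (phi : G -> H) :=
  [/\ {morph phi : x y / x * y}, continuous phi, dense (range phi) & tdlc H].

Definition top_group_isomorphism (G H : topGroupType) (psi : G -> H) :=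
  [/\ {morph psi : x y / x * y}, continuous psi &
      exists2 psi' : H -> G, continuous psi' &
        cancel psi psi' /\ cancel psi' psi].

Section Subgroups.
Variable G : groupType.
Implicit Types (U V W A B : set G) (x y g h : G).

Definition subgroup V := V 1 /\ forall x y, V x -> V y -> V (x / y).

Definition right_coset V g := [set v * g | v in V].

Definition conjugate g V := [set g * v * g^-1 | v in V].

Definition prod_set A B := [set a * b | a in A & b in B].

Definition finite_index V W := finite_set [set right_coset V g | g in W].

Definition commensurate U V :=
  finite_index (U `&` V) U /\ finite_index (U `&` V) V.

Lemma subgroupV V x : subgroup V -> V x -> V x^-1.
Proof. by move=> [V1 VD] /(VD _ _ V1); rewrite mul1g. Qed.

Lemma subgroupM V x y : subgroup V -> V x -> V y -> V (x * y).
Proof. by move=> sV Vx /(subgroupV sV)/(sV.2 _ _ Vx); rewrite invgK. Qed.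

Lemma right_cosetP V g x : right_coset V g x <-> V (x / g).
Proof.
split=> [[v Vv <-]|Vx]; first by rewrite mulgK.
by exists (x / g) => //; rewrite mulgVK.
Qed.

Lemma conjugateP V g x : conjugate g V x <-> V (g^-1 * x * g).
Proof.
split=> [[v Vv <-]|Vx]; first by rewrite !mulgA mulVg mul1g mulgVK.
by exists (g^-1 * x * g); rewrite // !mulgA mulgV mul1g mulgK.
Qed.

Lemma right_coset_id V g : subgroup V -> right_coset V g g.
Proof. by move=> sV; apply/right_cosetP; rewrite mulgV; apply: sV.1. Qed.

Lemma right_coset_eq V g x :
  subgroup V -> right_coset V g x -> right_coset V x = right_coset V g.
Proof.
move=> sV /right_cosetP Vxg; apply/seteqP; split=> y /right_cosetP Vy;
  apply/right_cosetP.
  by have := subgroupM sV Vy Vxg; rewrite !mulgA mulgVK.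
by have := subgroupM sV Vy (subgroupV sV Vxg); rewrite invgF !mulgA mulgVK.
Qed.

End Subgroups.

Record is_local_filter (G : topGroupType) (S : set (set G)) : Prop := {
  local_filter_open_subgroup : forall V, S V -> subgroup V /\ open V;
  local_filter_neq0 : S !=set0;
  local_filter_commensurate : forall U V, S U -> S V -> commensurate U V;
  (* only nonempty finite families: the empty one would put G itself in S *)
  local_filter_bigcap : forall F : set (set G), finite_set F -> F !=set0 ->
    F `<=` S -> S (\bigcap_(V in F) V);
  local_filter_up : forall V W, S V -> subgroup W -> V `<=` W ->
    finite_index V W -> S W;
  local_filter_conj : forall V g, S V -> S (conjugate g V) }.

Record local_filter (G : topGroupType) := LocalFilter {
  local_filter_sets :> set G -> Prop;
  local_filterP : is_local_filter local_filter_sets }.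

(* In cauchy_gen the coset inside A must itself lie in f: f is generated by    *)
(* its cosets of elements of S. Without this clause Cauchy filters would not   *)
(* be minimal: already for G = Z_p and S the set of open subgroups, there      *)
(* would be Cauchy filters strictly finer than the neighbourhood filter of 0,  *)
(* and the completion would be neither Hausdorff nor a group.                  *)
Record is_cauchy_filter (G : topGroupType) (S : set (set G))
    (f : set_system G) : Prop := {
  cauchy_filter : Filter f;
  cauchy_coset : forall V, S V -> exists! C, range (right_coset V) C /\ f C;
  cauchy_gen : forall A, f A -> exists V g,
    [/\ S V, f (right_coset V g) & right_coset V g `<=` A] }.

Record completion (G : topGroupType) (S : local_filter G) := Completion {
  completion_filter :> set G -> Prop;
  completionP : is_cauchy_filter S completion_filter }.

HB.instance Definition _ (G : topGroupType) (S : local_filter G) :=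
  gen_eqMixin (completion S).
HB.instance Definition _ (G : topGroupType) (S : local_filter G) :=
  gen_choiceMixin (completion S).

Section Completion.
Variables (G : topGroupType) (S : local_filter G).
Implicit Types (U V W A B : set G) (x y g h : G) (f : completion S).

Definition filter_mul (f f' : set_system G) : set_system G :=
  [set C | exists A B, [/\ f A, f' B & prod_set A B `<=` C]].

Definition filter_inv (f : set_system G) : set_system G :=
  [set C | f [set x | C x^-1]].

Definition point_filter g : set_system G :=
  [set C | exists2 V, S V & right_coset V g `<=` C].

Definition coset_entourage U : set (completion S * completion S) :=
  [set ff : completion S * completion S |
    exists g, ff.1 (right_coset U g) /\ ff.2 (right_coset U g)].

Definition completion_entourage : set_system (completion S * completion S) :=
  [set E | exists2 U, S U & coset_entourage U `<=` E].

Lemma local_filter_subgroup V : S V -> subgroup V.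
Proof. by case/(local_filter_open_subgroup (local_filterP S)). Qed.

Lemma local_filterI U V : S U -> S V -> S (U `&` V).
Proof.
move=> SU SV; have <- : \bigcap_(W in [set U; V]) W = U `&` V.
  by rewrite bigcap_setU !bigcap_set1.
apply: (local_filter_bigcap (local_filterP S)).
- exact: finite_set2.
- by exists U; left.
- by move=> W [->|->].
Qed.

Lemma local_filterJ V g : S V -> S (conjugate g V).
Proof. exact: (local_filter_conj (local_filterP S)). Qed.

Lemma completion_inj f f' : (f : set_system G) = f' -> f = f'.
Proof.
case: f f' => [f Pf] [f' Pf'] /= e; case: _ / e Pf' => Pf'.
by rewrite (Prop_irrelevance Pf Pf').
Qed.

#[local] Instance completion_Filter f : Filter f :=
  cauchy_filter (completionP f).

Lemma completion_ex f A : f A -> A !=set0.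
Proof.
move=> /(cauchy_gen (completionP f)) [V [g [SV _ VA]]].
by exists g; apply/VA/right_coset_id/local_filter_subgroup.
Qed.

Lemma completion_coset f V : S V -> exists g, f (right_coset V g).
Proof.
by move=> /(cauchy_coset (completionP f)) [_ [[[g _ <-] fC] _]]; exists g.
Qed.

Lemma completion_coset_eq f V g h : S V ->
  f (right_coset V g) -> f (right_coset V h) ->
  right_coset V g = right_coset V h.
Proof.
move=> SV fg fh; have [C [_ uC]] := cauchy_coset (completionP f) SV.
rewrite -(uC (right_coset V g)); last by split=> //; exists g.
by rewrite -(uC (right_coset V h)) //; split=> //; exists h.
Qed.

Lemma is_cauchyI (f : set_system G) : Filter f ->
  (forall V, S V -> exists g, f (right_coset V g)) ->
  (forall A, f A -> exists V g,
    [/\ S V, f (right_coset V g) & right_coset V g `<=` A]) ->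
  is_cauchy_filter S f.
Proof.
move=> Ff fV fA; split=> // V SV; have [g fg] := fV _ SV.
exists (right_coset V g); split; first by split=> //; exists g.
move=> _ [[h _ <-] fh]; have [W [k [SW _ sub]]] := fA _ (filterI fg fh).
have [kg kh] := sub k (right_coset_id k (local_filter_subgroup SW)).
have sV := local_filter_subgroup SV.
by rewrite -(right_coset_eq sV kg) (right_coset_eq sV kh).
Qed.

Lemma completion_sub_eq f f' : (f : set_system G) `<=` f' -> f = f'.
Proof.
move=> sub; apply/completion_inj/seteqP; split=> // A.
move=> /(cauchy_gen (completionP f')) [V [g [SV fg gA]]].
have [h fh] := completion_coset f SV.
apply: filterS gA _.
by rewrite (completion_coset_eq SV fg (sub _ fh)).
Qed.

Lemma point_filter_cauchy g : is_cauchy_filter S (point_filter g).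
Proof.
apply: is_cauchyI => [|V SV|A [V SV VA]]; last 2 first.
- by exists g; exists V.
- by exists V, g; split=> //; exists V.
split.
- by have [V SV] := local_filter_neq0 (local_filterP S); exists V.
- move=> P Q [V SV VP] [W SW WQ]; exists (V `&` W); first exact: local_filterI.
  by move=> x [v [Vv Wv] <-]; split; [apply: VP | apply: WQ]; exists v.
- by move=> P Q PQ [V SV VP]; exists V => //; apply: subset_trans PQ.
Qed.

Definition completion_beta g : completion S :=
  Completion (point_filter_cauchy g).

Lemma prod_coset V g h :
  subgroup V -> prod_set (right_coset V g) (right_coset (conjugate g^-1 V) h)
    `<=` right_coset V (g * h).
Proof.
move=> sV _ [_ [v Vv <-] [_ [w /conjugateP Ww <-] <-]].
apply/right_cosetP; rewrite invgK in Ww.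
by rewrite invgM !mulgA mulgK -!mulgA; apply: subgroupM; rewrite ?mulgA.
Qed.

Lemma filter_mul_cauchy f f' : is_cauchy_filter S (filter_mul f f').
Proof.
have coset V g : S V -> f (right_coset V g) -> exists2 h,
    f' (right_coset (conjugate g^-1 V) h) &
    filter_mul f f' (right_coset V (g * h)).
  move=> SV fg; have [h fh] := completion_coset f' (local_filterJ g^-1 SV).
  exists h => //; exists (right_coset V g), (right_coset (conjugate g^-1 V) h).
  by split=> //; apply/prod_coset/local_filter_subgroup.
apply: is_cauchyI => [|V SV|C [A [B [fA fB ABC]]]].
- split.
  + by exists setT, setT; split=> //; exact: filterT.
  + move=> P Q [A [B [fA fB sP]]] [A' [B' [fA' fB' sQ]]].
    exists (A `&` A'), (B `&` B'); split; [exact: filterI.. |].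
    move=> _ [a [Aa Aa'] [b [Bb Bb'] <-]].
    by split; [apply: sP | apply: sQ]; exists a => //; exists b.
  + move=> P Q PQ [A [B [fA fB sP]]]; exists A, B; split=> //.
    exact: subset_trans PQ.
- have [g fg] := completion_coset f SV.
  by have [h _ ?] := coset _ _ SV fg; exists (g * h).
- have [V [g [SV fg gA]]] := cauchy_gen (completionP f) fA.
  have [h fh fgh] := coset _ _ SV fg.
  have [b [Bb /right_cosetP hb]] := completion_ex (filterI fB fh).
  have sV := local_filter_subgroup SV.
  have gbh : right_coset V (g * h) (g * b).
    apply/right_cosetP; move/conjugateP: hb.
    by rewrite invgK invgM !mulgA.
  exists V, (g * b); rewrite (right_coset_eq sV gbh); split=> //.
  rewrite -(right_coset_eq sV gbh) => _ [v Vv <-]; apply: ABC.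
  by exists (v * g); [apply: gA; exists v | exists b; rewrite // mulgA].
Qed.

(* The only step which uses commensurability: the inverse of a filter          *)
(* generated by right cosets contains right cosets again.                      *)
Lemma completion_lcoset f V : S V -> exists x W,
  [/\ S W, f (right_coset W x) & right_coset W x `<=` [set y | V (x^-1 * y)]].
Proof.
move=> SV; have [g fg] := completion_coset f SV.
have sV := local_filter_subgroup SV.
pose U := V `&` conjugate g V.
have SU : S U by apply: local_filterI => //; exact: local_filterJ.
have sU := local_filter_subgroup SU.
have [fin _] : commensurate V (conjugate g V).
  apply: (local_filter_commensurate (local_filterP S)) => //.
  exact: local_filterJ.
pose F := [set conjugate v^-1 U | v in V].
have finF : finite_set F.
  suff -> : F = [set [set x | exists a b, [/\ C a, C b & x = a^-1 * b]] |
                 C in [set right_coset U v | v in V]] by exact: finite_image.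
  have e v : [set x | exists a b, [/\ right_coset U v a, right_coset U v b &
                                      x = a^-1 * b]] = conjugate v^-1 U.
    apply/seteqP; split=> x.
      move=> [_ [_ [[a Ua <-] [b Ub <-] ->]]].
      apply/conjugateP; rewrite invgK invgM !mulgA mulgV mul1g mulgK.
      by apply: subgroupM => //; exact: subgroupV.
    move=> /conjugateP; rewrite invgK => Ux.
    exists v, (v * x * v^-1 * v); split.
    - exact: right_coset_id.
    - by exists (v * x * v^-1).
    - by rewrite mulgVK mulKg.
  rewrite image_comp; apply: eq_imagel => v Vv; exact/esym/e.
have SW : S (\bigcap_(X in F) X).
  apply: (local_filter_bigcap (local_filterP S)) => //.
    by exists (conjugate 1^-1 U), 1 => //; exact: sV.1.
  by move=> _ [v Vv <-]; exact: local_filterJ.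
set W := \bigcap_(X in F) X in SW.
have [h fh] := completion_coset f SW.
have [x [hx /right_cosetP gx]] := completion_ex (filterI fh fg).
have sW := local_filter_subgroup SW.
exists x, W; rewrite (right_coset_eq sW hx); split=> //.
rewrite -(right_coset_eq sW hx) => _ [w Ww <-] /=.
have /Ww/conjugateP : F (conjugate (x / g)^-1^-1 U).
  by exists (x / g)^-1 => //; exact: subgroupV.
rewrite invgK => -[_ /conjugateP].
by rewrite invgF !mulgA mulVg mul1g invgF !mulgA mulgVK.
Qed.

Lemma filter_inv_cauchy f : is_cauchy_filter S (filter_inv f).
Proof.
have Ff : Filter (filter_inv f).
  split; first exact: filterT.
    by move=> P Q; exact: filterI.
  by move=> P Q PQ; apply: filterS => x; exact: PQ.
apply: is_cauchyI => [V SV|C fC].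
- have [x [W [SW fW sub]]] := completion_lcoset f SV.
  exists x^-1; apply: filterS fW => y /sub /= Vy; apply/right_cosetP.
  rewrite invgK -[y^-1 * x]invgK invgM invgK.
  exact: (subgroupV (local_filter_subgroup SV) Vy).
- have [V [g [SV fg gC]]] := cauchy_gen (completionP f) fC.
  exists (conjugate g^-1 V), g^-1; have e :
      right_coset (conjugate g^-1 V) g^-1 = [set x^-1 | x in right_coset V g].
    apply/seteqP; split=> x.
      move=> /right_cosetP/conjugateP; rewrite !invgK !mulgA mulgK => Vx.
      exists x^-1; last by rewrite invgK.
      apply/right_cosetP; rewrite -invgM.
      exact: (subgroupV (local_filter_subgroup SV) Vx).
    move=> [y /right_cosetP Vy <-].
    apply/right_cosetP/conjugateP; rewrite !invgK !mulgA mulgK.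
    rewrite -[g * _]invgK invgM invgK.
    exact: (subgroupV (local_filter_subgroup SV) Vy).
  split; first exact: local_filterJ.
    rewrite e; apply: filterS fg => y gy /=.
    by exists y.
  by rewrite e => _ [y /gC Cy <-].
Qed.

Definition completion_mul f f' : completion S :=
  Completion (filter_mul_cauchy f f').

Definition completion_one := completion_beta 1.

Definition completion_inv f : completion S := Completion (filter_inv_cauchy f).

Lemma completion_mulA : associative completion_mul.
Proof.
move=> f1 f2 f3; apply: completion_sub_eq => D.
move=> [A [BC [fA [B [C [fB fC sBC]]] sD]]].
exists (prod_set A B), C; split=> //; first by exists A, B; split.
move=> _ [_ [a Aa [b Bb <-]] [c Cc <-]]; apply: sD.
rewrite -mulgA; exists a => //; exists (b * c) => //.
by apply: sBC; exists b => //; exists c.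
Qed.

Lemma completion_mul1g : left_id completion_one completion_mul.
Proof.
move=> f; apply: completion_sub_eq => C [A [B [[V SV VA] fB sC]]].
apply: filterS fB => b Bb; apply: sC; exists 1; last by exists b; rewrite ?mul1g.
exact/VA/right_coset_id/local_filter_subgroup.
Qed.

Lemma completion_mulg1 : right_id completion_one completion_mul.
Proof.
move=> f; apply: completion_sub_eq => C [A [B [fA [V SV VB] sC]]].
apply: filterS fA => a Aa; apply: sC; exists a => //; exists 1; rewrite ?mulg1//.
exact/VB/right_coset_id/local_filter_subgroup.
Qed.

Lemma completion_mulV :
  right_inverse completion_one completion_inv completion_mul.
Proof.
move=> f; apply/esym/completion_sub_eq => C [V SV VC].
have [g fg] := completion_coset f SV.
exists (right_coset V g), [set x | right_coset V g x^-1]; split=> //.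
  by rewrite /= /filter_inv /=; apply: filterS fg => x /=; rewrite invgK.
move=> _ [a /right_cosetP Va [b /right_cosetP Vb <-]]; apply: VC.
apply/right_cosetP; rewrite invg1 mulg1.
have := (local_filter_subgroup SV).2 _ _ Va Vb.
by rewrite invgF invgK mulgA mulgVK.
Qed.

Lemma completion_invK f : completion_inv (completion_inv f) = f.
Proof.
apply: completion_inj; apply: funext => A.
rewrite /= /filter_inv /=; congr (_ _); apply/funext => x /=.
by rewrite invgK.
Qed.

Lemma completion_mulVg :
  left_inverse completion_one completion_inv completion_mul.
Proof. by move=> f; rewrite -{2}[f]completion_invK completion_mulV. Qed.

HB.instance Definition _ := isGroup.Build (completion S)
  completion_mulA completion_mul1g completion_mulg1
  completion_mulVg completion_mulV.

Lemma completion_entourage_filter : Filter completion_entourage.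
Proof.
split.
- by have [U SU] := local_filter_neq0 (local_filterP S); exists U.
- move=> P Q [U SU UP] [V SV VQ]; exists (U `&` V); first exact: local_filterI.
  move=> [f f'] /= [g [fg fg']]; split; [apply: UP | apply: VQ]; exists g;
    by split; [apply: filterS fg | apply: filterS fg'] => _ [x [? ?] <-];
      exists x.
- by move=> P Q PQ [U SU UP]; exists U => //; apply: subset_trans PQ.
Qed.

Lemma completion_entourage_refl E :
  completion_entourage E -> (diagonal `<=` E)%relation.
Proof.
move=> [U SU UE] [f f'] e; have <- : f = f' := e.
by apply: UE => /=; have [g fg] := completion_coset f SU; exists g.
Qed.

Lemma completion_entourage_inv E :
  completion_entourage E -> completion_entourage (E^-1)%relation.
Proof.
by move=> [U SU UE]; exists U => // -[f f'] /= [g [? ?]]; apply: UE; exists g.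
Qed.

Lemma completion_entourage_split E : completion_entourage E ->
  exists2 B, completion_entourage B & (B \; B `<=` E)%relation.
Proof.
move=> [U SU UE]; exists (coset_entourage U); first by exists U.
move=> [f f'] /= [k [g [fg kg]] [h [kh fh]]]; apply: UE; exists g; split=> //=.
by rewrite (completion_coset_eq SU kg kh).
Qed.

HB.instance Definition _ := isUniform.Build (completion S)
  completion_entourage_filter completion_entourage_refl
  completion_entourage_inv completion_entourage_split.

Lemma nbhs_completionP f (P : set (completion S)) : nbhs f P <->
  exists V g, [/\ S V, f (right_coset V g) &
    forall f', completion_filter f' (right_coset V g) -> P f'].
Proof.
rewrite -nbhs_entourageE; split=> [[E [V SV VE] EP]|[V [g [SV fg VP]]]].
  have [g fg] := completion_coset f SV; exists V, g; split=> // f' f'g.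
  by apply: EP; apply/mem_set/VE; exists g.
exists (coset_entourage V); first by exists V.
move=> f' /set_mem /= [h [fh f'h]]; apply: VP.
by rewrite (completion_coset_eq SV fg fh).
Qed.

Lemma completion_mul_continuous :
  continuous (fun p : completion S * completion S => p.1 * p.2).
Proof.
move=> [f f'] /= P /nbhs_completionP [V [k [SV fk VP]]].
have [g fg] := completion_coset f SV.
have SW := local_filterJ g^-1 SV.
have [h f'h] := completion_coset f' SW.
have mulV f1 f2 : completion_filter f1 (right_coset V g) ->
    completion_filter f2 (right_coset (conjugate g^-1 V) h) ->
    completion_filter (f1 * f2) (right_coset V (g * h)).
  move=> f1g f2h.
  exists (right_coset V g), (right_coset (conjugate g^-1 V) h); split=> //.
  exact/prod_coset/local_filter_subgroup.
exists ([set f1 | completion_filter f1 (right_coset V g)],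
        [set f2 | completion_filter f2 (right_coset (conjugate g^-1 V) h)]).
  by split; apply/nbhs_completionP; [exists V, g | exists (conjugate g^-1 V), h].
move=> [f1 f2] /= [f1g f2h]; apply: VP.
by rewrite (completion_coset_eq SV fk (mulV _ _ fg f'h)); exact: mulV.
Qed.

Lemma completion_inv_continuous : continuous (fun f : completion S => f^-1).
Proof.
move=> f P /nbhs_completionP [V [k [SV fk VP]]].
have [W [g [SW fg sub]]] := cauchy_gen (completionP f) fk.
apply/nbhs_completionP; exists W, g; split=> // f' f'g; apply: VP.
exact: filterS f'g.
Qed.

Lemma completion_hausdorff : hausdorff_space (completion S).
Proof.
move=> f f' ff'; apply: completion_sub_eq => A /(cauchy_gen (completionP f)).
move=> [V [g [SV fg gA]]]; have [h f'h] := completion_coset f' SV.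
have [f1 [/= f1g f1h]] : [set f1 : completion S | f1 (right_coset V g)] `&`
    [set f1 : completion S | f1 (right_coset V h)] !=set0.
  by apply: ff'; apply/nbhs_completionP; [exists V, g | exists V, h].
by apply: filterS gA _; rewrite (completion_coset_eq SV f1g f1h).
Qed.

HB.instance Definition _ := isTopGroup.Build (completion S)
  completion_mul_continuous completion_inv_continuous completion_hausdorff.

End Completion.

(* Main.v *)
Require Import Defs.
From mathcomp Require Import all_boot.
From mathcomp Require Import all_classical.
From mathcomp Require Import topology.

Set Implicit Arguments.
Unset Strict Implicit.
Unset Printing Implicit Defensive.

(** Every t.d.l.c. group H is recovered from the traces of its compact open
    subgroups on a dense subgroup.  Given phi : G -> H, let S consist of the
    subgroups of G of the form phi^-1(K), with K a compact open subset of H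
    [trace_local_filter].  Commensurability holds because finitely many
    translates of a neighbourhood of 1 cover a compact set
    [trace_finite_index], and S is nonempty and fine enough because the compact
    open subgroups of H form a neighbourhood basis of 1 [van_dantzig].

    An S-Cauchy filter f pushes forward along phi to a filter on H which
    contains, for every compact open subgroup L, a coset of L.  Such a coset
    is compact, so there is a cluster point x; any coset of L in the
    push-forward meets L x, hence equals L x, so that the push-forward converges
    to x [limit_along_ex].  The isomorphism psi sends f to this limit.  Its
    inverse sends x to the trace on G of the neighbourhood filter of x, which is
    Cauchy because phi has dense image [trace_nbhs_cauchy].  One composite is the
    identity because limits are unique, the other because an inclusion between
    Cauchy filters is an equality.

    For uniqueness, any continuous psi with phi = psi \o beta maps f to a limit
    of the push-forward of f [continuous_extension_limit], and H is Hausdorff.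
*)

Local Open Scope classical_set_scope.
Local Open Scope group_scope.

(** * Compact sets *)

Section Compactness.
Variable T : topologicalType.
Implicit Types (A B K O : set T) (x : T).

(** The finite cover property as an induction principle: if P K failed, the
    sets whose complement in K satisfies P would form a proper filter containing
    K, and no point of K could be a cluster point of it. *)
Lemma compact_local_ind (P : set T -> Prop) K :
  P set0 -> (forall A B, P A -> P B -> P (A `|` B)) ->
  (forall A B, A `<=` B -> P B -> P A) ->
  (forall x, K x -> exists2 N, nbhs x N & P N) ->
  compact K -> P K.
Proof.
move=> P0 PU Psub Ploc cK; apply: contrapT => nPK.
pose F : set_system T := [set A | P (K `\` A)].
have FF : ProperFilter F.
  split; first by rewrite /F /= setD0.
  split=> [|A B PA PB|A B AB]; rewrite /F /=.
  - by rewrite setDT.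
  - by rewrite setDIr; exact: PU.
  - by apply: Psub; exact: setDS.
have FK : F K by rewrite /F /= setDv.
have [x [Kx clx]] := cK F FF FK; have [N xN PN] := Ploc x Kx.
have FN : F (~` N) by apply: Psub PN => y [_ /contrapT].
by have [y []] := clx _ _ FN xN.
Qed.

(** Near a point of K outside O some member of D is absent; finitely many of
    these members suffice for all of K, and D is closed under intersection. *)
Lemma closed_family_shrink (D : set (set T)) K O :
  D !=set0 -> (forall A B, D A -> D B -> D (A `&` B)) ->
  (forall A, D A -> closed A) -> compact K -> open O ->
  K `&` \bigcap_(A in D) A `<=` O ->
  exists2 A, D A & K `&` A `<=` O.
Proof.
move=> D0 DI Dcl cK oO sub.
have [|A B [A' DA sA] [B' DB sB]|A B AB [C DC sC]|x Kx|A DA sA] :=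
  @compact_local_ind (fun B => exists2 A, D A & B `&` A `<=` O) K _ _ _ _ cK.
- by have [A DA] := D0; exists A => //; rewrite set0I.
- exists (A' `&` B'); first exact: DI.
  by move=> x [[Ax|Bx] [A'x B'x]]; [apply: sA | apply: sB].
- by exists C => //; exact: subset_trans (setSI AB) sC.
- have [Ox|nOx] := pselect (O x).
    have [A DA] := D0; exists O; first exact: open_nbhs_nbhs.
    by exists A => // y [].
  have [A DA nAx] : exists2 A, D A & ~ A x.
    apply: contrapT => nA; apply: nOx; apply: sub; split=> [//|A DA].
    by apply: contrapT => nAx; apply: nA; exists A.
  exists (~` A); last by exists A => // y [].
  by apply: open_nbhs_nbhs; split=> //; apply: closed_openC; apply: Dcl.
- by exists A.
Qed.

Definition compact_open K := compact K /\ open K.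

Lemma compact_open0 : compact_open set0.
Proof. by split; [exact: compact0 | exact: open0]. Qed.

Lemma compact_openU A B :
  compact_open A -> compact_open B -> compact_open (A `|` B).
Proof.
by move=> [cA oA] [cB oB]; split; [exact: compactU | exact: openU].
Qed.

Lemma compact_openI A B : hausdorff_space T ->
  compact_open A -> compact_open B -> compact_open (A `&` B).
Proof.
move=> hT [cA oA] [cB oB]; split; last exact: openI.
by apply: compact_closedI => //; exact: compact_closed.
Qed.

End Compactness.

Lemma compact_open_preimage (T U : topologicalType) (a : U -> T) (b : T -> U) K :
  continuous a -> continuous b -> cancel a b -> cancel b a ->
  compact_open K -> compact_open (a @^-1` K).
Proof.
move=> ca cb ab ba [cK oK]; split; last by move/continuousP: ca; apply.
have -> : a @^-1` K = b @` K.
  apply/seteqP; split=> [x Kx|_ [y Ky <-]] /=; last by rewrite ba.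
  by exists (a x).
exact/continuous_compact/cK/continuous_subspaceT.
Qed.

(** * Topological groups *)

Section TopologicalGroups.
Variable H : topGroupType.
Implicit Types (x y z : H) (A B K N O : set H).

Lemma divg_continuous : continuous (fun p : H * H => p.1 / p.2).
Proof.
move=> [x y] N /(@mulg_continuous H (x, y^-1)) [[A B] /= [xA yB] sub].
exists (A, [set z | B z^-1]); first by split=> //; exact: invg_continuous.
by move=> [a b] /= [Aa Bb]; exact: (sub (a, b^-1)).
Qed.

Lemma mulgr_continuous x : continuous (fun y => y * x).
Proof.
move=> y N /(@mulg_continuous H (y, x)) [[A B] /= [yA xB] sub].
apply: filterS yA => a Aa; apply: (sub (a, x)); split=> //=.
exact: nbhs_singleton.
Qed.

Lemma mulgl_continuous x : continuous (fun y => x * y).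
Proof.
move=> y N /(@mulg_continuous H (x, y)) [[A B] /= [xA yB] sub].
apply: filterS yB => b Bb; apply: (sub (x, b)); split=> //=.
exact: nbhs_singleton.
Qed.

Lemma compact_open_right_coset K x :
  compact_open K -> compact_open (right_coset K x).
Proof.
have -> : right_coset K x = (fun y => y / x) @^-1` K.
  by apply/funext => y; apply/propext; exact: right_cosetP.
apply: (@compact_open_preimage _ _ _ (fun y => y * x)).
- exact: mulgr_continuous.
- exact: mulgr_continuous.
- by move=> y; rewrite mulgVK.
- by move=> y; rewrite mulgK.
Qed.

Lemma compact_open_conjugate K x :
  compact_open K -> compact_open (conjugate x K).
Proof.
have c z : continuous (fun y => z^-1 * y * z).
  move=> y N /(@mulgr_continuous z (z^-1 * y)).
  exact: (@mulgl_continuous z^-1 y).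
have -> : conjugate x K = (fun y => x^-1 * y * x) @^-1` K.
  by apply/funext => y; apply/propext; exact: conjugateP.
apply: (@compact_open_preimage _ _ _ (fun y => x^-1^-1 * y * x^-1)) => // y.
  by rewrite invgK !mulgA mulgV mul1g mulgK.
by rewrite invgK !mulgA mulVg mul1g mulgVK.
Qed.

Lemma nbhs_right_coset N x : nbhs 1 N -> nbhs x (right_coset N x).
Proof.
move=> N1; have xN : nbhs x [set y | N (y * x^-1)].
  by apply: (@mulgr_continuous x^-1 x); rewrite mulgV.
by apply: filterS xN => y Ny; apply/right_cosetP.
Qed.

Lemma nbhs_mulgr1 N x : nbhs x N -> nbhs 1 [set z | N (z * x)].
Proof. by move=> xN; apply: (@mulgr_continuous x 1); rewrite mul1g. Qed.

Lemma divg_nbhs N x y : nbhs (x / y) N -> exists A B,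
  [/\ nbhs x A, nbhs y B & forall a b, A a -> B b -> N (a / b)].
Proof.
move=> /(@divg_continuous (x, y)) [[A B] /= [xA yB] sub].
by exists A, B; split=> // a b Aa Bb; exact: (sub (a, b)).
Qed.

(** The tube lemma for the multiplication: each k in K has a neighbourhood whose
    product with some neighbourhood of 1 stays in O, and K is compact. *)
Lemma compact_mul_nbhs K O : compact K -> open O -> K `<=` O ->
  exists2 W, nbhs 1 W & forall k w, K k -> W w -> O (k * w).
Proof.
move=> /compact_near_coveringP cK oO KO.
have W1 : nbhs 1 [set w | K `<=` [set k | O (k * w)]].
  apply: (cK H (nbhs 1) (fun w k => O (k * w))) => k Kk.
  apply: (@mulg_continuous H (k, 1)); rewrite /= mulg1.
  by apply: open_nbhs_nbhs; split=> //; exact: KO.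
by exists [set w | K `<=` [set k | O (k * w)]] => // k w Kk /(_ k Kk).
Qed.

(** By [compact_mul_nbhs], A W misses B for a neighbourhood W of 1; if C is
    so small that c / c' lies in W for all c, c' in C, then A C and B C are
    disjoint. *)
Lemma compact_separated A B : compact A -> compact B -> A `&` B = set0 ->
  exists U V : set H,
    [/\ open U, open V, A `<=` U, B `<=` V & U `&` V = set0].
Proof.
move=> cA cB AB0.
have [|a Aa Ba|W W1 AWB] := @compact_mul_nbhs A (~` B) cA.
- by apply: closed_openC; apply: compact_closed cB; exact: topgroup_hausdorff.
- by rewrite -[False]/(set0 a) -AB0.
have [|W1' [W2' [W1'1 W2'1 sub]]] := @divg_nbhs W 1 1; first by rewrite mulgV.
pose C := (W1' `&` W2')°.
have C1 : C 1.
  by apply: nbhs_singleton; apply: nbhs_interior; exact: filterI.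
have thick D : open (\bigcup_(d in D) [set y | C (d^-1 * y)]).
  apply: bigcup_open => d _.
  have /continuousP := @mulgl_continuous d^-1; apply; exact: open_interior.
have self D : D `<=` \bigcup_(d in D) [set y | C (d^-1 * y)].
  by move=> d Dd; exists d; rewrite //= mulVg.
exists (\bigcup_(a in A) [set y | C (a^-1 * y)]),
       (\bigcup_(b in B) [set y | C (b^-1 * y)]); split=> //.
apply/seteqP; split=> // y [[a Aa /interior_subset [/= Wa _]]].
move=> [b Bb /interior_subset [/= _ Wb]].
have := AWB a _ Aa (sub _ _ Wa Wb); apply.
by rewrite invgM invgK !mulgA mulgV mul1g mulgV mul1g.
Qed.

(** Inside a compact neighbourhood C of x, the intersection Q of all relatively
    clopen sets containing x is connected: a splitting of Q into two closed
    pieces extends to disjoint open sets U, V, and some relatively clopen A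
    lies in U `|` V, so that cutting A down to U gives a smaller relatively
    clopen set containing x.  Hence Q = [set x], and some relatively clopen A
    lies in the interior of N `&` C, where it is genuinely open. *)
Lemma tdlc_compact_open_nbhs x N : tdlc H -> nbhs x N ->
  exists K, [/\ compact_open K, K x & K `<=` N].
Proof.
move=> [td lc] xN.
have [C] := lc x I; rewrite withinET => xC [cC clC].
pose N' := (N `&` C)°.
have N'x : N' x by apply: nbhs_singleton; apply: nbhs_interior; exact: filterI.
pose D : set (set H) := [set A | [/\ A x, closed A, A `<=` C &
  exists2 O, open O & A = C `&` O]].
pose Q := \bigcap_(A in D) A.
have DC : D C.
  by split=> //; [exact: nbhs_singleton | exists setT; [exact: openT | rewrite setIT]].
have DI A B : D A -> D B -> D (A `&` B).
  move=> [Ax clA AsubC [O oO AO]] [Bx clB BsubC [O' oO' BO']]; split=> //.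
  - exact: closedI.
  - by move=> y [/AsubC].
  - by exists (O `&` O'); [exact: openI | rewrite AO BO' setIACA setIid].
have Dcl A : D A -> closed A by case.
have shrink O : open O -> Q `<=` O -> exists2 A, D A & A `<=` O.
  move=> oO QO.
  have [||A DA sA] := @closed_family_shrink H D C O _ DI Dcl cC oO.
  - by exists C.
  - by move=> y [_ /QO].
  - by exists A => // y Ay; apply: sA; split=> //; have [_ _ AsubC _] := DA; exact: AsubC.
have clQ : closed Q by exact: closed_bigI.
have QC : Q `<=` C by move=> y; exact.
have Qx : Q x by move=> A [].
have split_empty A1 A2 : closed A1 -> closed A2 -> A1 `|` A2 = Q ->
    A1 `&` A2 = set0 -> A1 x -> A2 = set0.
  move=> clA1 clA2 A12Q A120 A1x.
  have [||//|U [V [oU oV A1U A2V UV0]]] := @compact_separated A1 A2.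
  - by apply: subclosed_compact cC _ => // y ?; apply: QC; rewrite -A12Q; left.
  - by apply: subclosed_compact cC _ => // y ?; apply: QC; rewrite -A12Q; right.
  have nUV y : U y -> V y -> False.
    by move=> Uy Vy; rewrite -[False]/(set0 y) -UV0.
  have [||A [Ax clA AsubC [O oO AO]] AUV] := shrink (U `|` V); first exact: openU.
    by rewrite -A12Q; exact: setUSS.
  (* A `\` V is closed, and equal to A `&` U it is relatively open. *)
  have DAV : D (A `&` ~` V).
    split.
    - by split=> // Vx; apply: nUV Vx; exact: A1U.
    - by apply: closedI => //; exact: open_closedC.
    - by move=> y [/AsubC].
    exists (O `&` U); first exact: openI.
    apply/seteqP; split=> y.
      by move=> [Ay nVy]; have [//|] := AUV y Ay; move: Ay; rewrite {1}AO => -[].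
    move=> [Cy [Oy Uy]]; split; first by rewrite AO.
    by move=> Vy; exact: nUV Vy.
  apply/seteqP; split=> // y A2y.
  have Qy : Q y by rewrite -A12Q; right.
  by have [_ nVy] := Qy _ DAV; apply: nVy; exact: A2V.
have conQ : connected Q.
  move=> B [b Bb] [O oO BO] [O' clO' BO'].
  have clB : closed B by rewrite BO'; exact: closedI.
  have clB' : closed (Q `&` ~` O) by apply: closedI => //; exact: open_closedC.
  have BQ : B `|` Q `&` ~` O = Q by rewrite BO -setIUr setUCr setIT.
  have BQ0 : B `&` (Q `&` ~` O) = set0 by rewrite BO setIACA setICr setI0.
  have [Ox|nOx] := pselect (O x).
    rewrite -BQ (split_empty _ _ clB clB' BQ BQ0) ?setU0//.
    by rewrite BO.
  have B0 : B = set0.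
    by apply: (split_empty _ _ clB' clB); [rewrite setUC | rewrite setIC |].
  by move: Bb; rewrite B0.
have [||A [Ax clA AsubC [O oO AO]] AN'] := shrink N'; first exact: open_interior.
  move=> y Qy; have : connected_component [set: H] x y by exists Q.
  by rewrite td// => ->.
exists A; split=> //; last by move=> y /AN' /interior_subset [].
split; first exact: subclosed_compact cC _.
have -> : A = N' `&` O; last by apply: openI => //; exact: open_interior.
apply/seteqP; split=> y.
  by move=> Ay; split; [exact: AN' | move: Ay; rewrite AO => -[]].
by move=> [/interior_subset [_ Cy] Oy]; rewrite AO.
Qed.

(** Take a compact open K inside N: the right stabiliser L of K lies in K as K
    contains 1, and it is open since K W `<=` K for some neighbourhood W of 1,
    so that L contains W `&` W^-1. *)
Lemma van_dantzig N : tdlc H -> nbhs 1 N ->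
  exists L, [/\ subgroup L, compact_open L & L `<=` N].
Proof.
move=> tH N1; have [K [[cK oK] K1 KN]] := tdlc_compact_open_nbhs tH N1.
pose L := [set z | forall k, K k -> K (k * z) /\ K (k / z)].
have sL : subgroup L.
  split=> [k Kk|y z Ly Lz k Kk]; first by rewrite divg1 mulg1.
  rewrite invgF !mulgA; split.
    by apply: (Lz _ _).2; exact: (Ly k Kk).1.
  by apply: (Ly _ _).2; exact: (Lz k Kk).1.
have LK : L `<=` K by move=> z /(_ 1 K1) []; rewrite mul1g.
have [W W1 KW] := compact_mul_nbhs cK oK (@subset_refl _ K).
have W1' : nbhs 1 [set z : H | W z^-1].
  by apply: (@invg_continuous H 1); rewrite invg1.
have L1 : nbhs 1 L.
  apply: filterS (filterI W1 W1') => z [Wz /= Wz'] k Kk.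
  by split; exact: KW.
have oL : open L.
  rewrite openE => z Lz; rewrite /interior.
  apply: filterS (nbhs_right_coset z L1) => y /right_cosetP Lyz.
  by have := subgroupM sL Lyz Lz; rewrite mulgVK.
exists L; split=> //; last exact: subset_trans KN.
split=> //; apply: subclosed_compact cK LK.
rewrite -[L]setCK; apply: open_closedC; rewrite openE => z nLz; rewrite /interior.
apply: filterS (nbhs_right_coset z L1) => y /right_cosetP Lyz Ly; apply: nLz.
by have := sL.2 _ _ (subgroupV sL Lyz) (subgroupV sL Ly); rewrite invgF invgK mulgVK.
Qed.

Lemma van_dantzig_coset x N : tdlc H -> nbhs x N ->
  exists L, [/\ subgroup L, compact_open L & right_coset L x `<=` N].
Proof.
move=> tH /nbhs_mulgr1/(van_dantzig tH) [L [sL cL LN]].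
by exists L; split=> // _ [l /LN Nl <-].
Qed.

End TopologicalGroups.

(** * Preimages under group morphisms *)

Section MorphismPreimages.
Variables (G H : groupType) (phi : G -> H).
Hypothesis phiM : {morph phi : g h / g * h}.
Implicit Types (L : set H) (g h : G).

Lemma morphg1 : phi 1 = 1.
Proof. by apply: (@mulgI H (phi 1)); rewrite -phiM !mulg1. Qed.

Lemma morphgV g : phi g^-1 = (phi g)^-1.
Proof. by apply: (@mulgI H (phi g)); rewrite -phiM !mulgV morphg1. Qed.

Lemma morphgF g h : phi (g / h) = phi g / phi h.
Proof. by rewrite phiM morphgV. Qed.

Lemma preimage_subgroup L : subgroup L -> subgroup (phi @^-1` L).
Proof.
move=> sL; split=> [|g h Lg Lh]; first by rewrite /preimage /= morphg1; exact: sL.1.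
by rewrite /preimage /= morphgF; exact: sL.2.
Qed.

Lemma preimage_right_coset L g :
  phi @^-1` (right_coset L (phi g)) = right_coset (phi @^-1` L) g.
Proof.
apply/seteqP; split=> h /right_cosetP Lh; apply/right_cosetP.
  by rewrite /preimage /= morphgF.
by rewrite -morphgF.
Qed.

Lemma preimage_conjugate L g :
  phi @^-1` (conjugate (phi g) L) = conjugate g (phi @^-1` L).
Proof.
apply/seteqP; split=> h /conjugateP Lh; apply/conjugateP.
  by rewrite /preimage /= !phiM morphgV.
by rewrite -morphgV -!phiM.
Qed.

End MorphismPreimages.

(** * The local filter of a completion map *)

Section CompactOpenTraces.
Variables (G H : topGroupType) (phi : G -> H).
Hypothesis hphi : tdlc_completion_map phi.
Implicit Types (U V W A B : set G) (K L N : set H) (g h : G) (x y : H).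

Let phiM : {morph phi : g h / g * h}. Proof. by case: hphi. Qed.
Let phi_cont : continuous phi. Proof. by case: hphi. Qed.
Let H_tdlc : tdlc H. Proof. by case: hphi. Qed.
Let H_hausdorff : hausdorff_space H. Proof. exact: topgroup_hausdorff. Qed.

Let phi1 : phi 1 = 1. Proof. exact: morphg1. Qed.
Let phiF g h : phi (g / h) = phi g / phi h. Proof. exact: morphgF. Qed.

(** K ranges over all compact open subsets rather than subgroups: traces are
    then closed under finite unions, and in particular a finite-index overgroup
    of a trace, being a finite union of its cosets, is again a trace. *)
Definition compact_open_trace : set (set G) :=
  [set A | exists2 K, compact_open K & A = phi @^-1` K].

Lemma traceU A B : compact_open_trace A -> compact_open_trace B ->
  compact_open_trace (A `|` B).
Proof.
move=> [K cK ->] [L cL ->]; exists (K `|` L) => //; exact: compact_openU.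
Qed.

Lemma traceI A B : compact_open_trace A -> compact_open_trace B ->
  compact_open_trace (A `&` B).
Proof.
move=> [K cK ->] [L cL ->]; exists (K `&` L) => //; exact: compact_openI.
Qed.

Lemma trace_bigcup (F : set (set G)) : finite_set F ->
  F `<=` compact_open_trace -> compact_open_trace (\bigcup_(A in F) A).
Proof.
move=> /finite_fsetP [X ->] FT; rewrite bigcup_fset big_seq; apply: big_ind.
- exists set0; [exact: compact_open0 | by rewrite preimage_set0].
- exact: traceU.
- by move=> A; exact: FT.
Qed.

Lemma trace_bigcap (F : set (set G)) : finite_set F -> F !=set0 ->
  F `<=` compact_open_trace -> compact_open_trace (\bigcap_(A in F) A).
Proof.
move=> finF [A0 FA0] FT.
have -> : \bigcap_(A in F) A = A0 `&` \bigcap_(A in F) A.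
  by apply/esym/setIidr => g; exact.
move: finF FA0 FT => /finite_fsetP [X ->] XA0 FT; rewrite bigcap_fset big_seq.
pose P A := compact_open_trace (A0 `&` A); rewrite -/(P _); apply: big_ind.
- by rewrite /P setIT; exact: FT.
- by move=> A B PA PB; rewrite /P -(setIid A0) setIACA; exact: traceI.
- by move=> A XA; apply: traceI; exact: FT.
Qed.

(** With U = phi^-1(L) and A = phi^-1(K), every point of H has a neighbourhood
    N with N N^-1 `<=` L, and the elements of phi^-1(N) all lie in one coset of
    U; compactness of K does the rest. *)
Lemma trace_finite_index A U : compact_open_trace A -> compact_open_trace U ->
  subgroup U -> finite_index U A.
Proof.
move=> [K [cK _] ->] [L [_ oL] UL] sU.
pose P (B : set H) :=
  finite_set [set right_coset U g | g in phi @^-1` B].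
have L1 : nbhs (1 : H) L.
  apply: open_nbhs_nbhs; split=> //; rewrite -phi1.
  by have := sU.1; rewrite UL.
apply: (@compact_local_ind H P K _ _ _ _ cK) => [|A' B PA PB|A' B AB|x _].
- by rewrite /P preimage_set0 image_set0; exact: finite_set0.
- by rewrite /P preimage_setU image_setU finite_setU.
- by apply: sub_finite_set; apply: image_subset; exact: preimage_subset.
have [|C [D [xC xD CDL]]] := @divg_nbhs H L x x; first by rewrite mulgV.
exists (C `&` D); first exact: filterI.
have [[g [Cg Dg]]|none] := pselect (exists g, (C `&` D) (phi g)).
  apply: (@sub_finite_set _ _ [set right_coset U g]) => [_ [h [Ch Dh] <-]|].
    apply: right_coset_eq => //; apply/right_cosetP; rewrite UL /preimage /= phiF.
    exact: CDL.
  exact: finite_set1.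
apply: (@sub_finite_set _ _ set0) => [X [h CDh _]|]; last exact: finite_set0.
by apply: none; exists h.
Qed.

Lemma trace_local_filter :
  is_local_filter [set V | subgroup V /\ compact_open_trace V].
Proof.
split.
- by move=> V [sV [K [_ oK] VK]]; split=> //; rewrite VK;
    move/continuousP: phi_cont; apply.
- have [L [sL cL _]] := van_dantzig H_tdlc (@filterT _ (nbhs (1 : H)) _).
  by exists (phi @^-1` L); split; [exact: preimage_subgroup | exists L].
- move=> U V [sU tU] [sV tV].
  have sUV : subgroup (U `&` V).
    split; first by split; [exact: sU.1 | exact: sV.1].
    by move=> g h [Ug Vg] [Uh Vh]; split; [exact: sU.2 | exact: sV.2].
  by split; apply: trace_finite_index => //; exact: traceI.
- move=> F finF F0 FS; split; last first.
    by apply: trace_bigcap => // V /FS [].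
  split=> [V /FS [sV _]|g h Fg Fh V FV]; first exact: sV.1.
  by have [sV _] := FS V FV; apply: sV.2; [exact: Fg | exact: Fh].
- move=> V W [sV [K cK VK]] sW VW fin; split=> //.
  have -> : W = \bigcup_(C in [set right_coset V g | g in W]) C.
    apply/seteqP; split=> [g Wg|g [_ [h Wh <-] [v Vv <-]]].
      by exists (right_coset V g); [exists g | exact: right_coset_id].
    by apply: subgroupM => //; exact: VW.
  apply: trace_bigcup => // _ [g _ <-]; exists (right_coset K (phi g)).
    exact: compact_open_right_coset.
  by rewrite (preimage_right_coset phiM) VK.
- move=> V g [sV [K cK VK]]; split.
    split=> [|h k /conjugateP Vh /conjugateP Vk]; apply/conjugateP.
      by rewrite mulg1 mulVg; exact: sV.1.
    by have := sV.2 _ _ Vh Vk; rewrite !invgM invgK !mulgA mulgK.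
  exists (conjugate (phi g) K); first exact: compact_open_conjugate.
  by rewrite (preimage_conjugate phiM) VK.
Qed.

Definition trace_filter : local_filter G := LocalFilter trace_local_filter.

Lemma trace_filter_preimage L :
  subgroup L -> compact_open L -> trace_filter (phi @^-1` L).
Proof. by move=> sL cL; split; [exact: preimage_subgroup | exists L]. Qed.

(** * The isomorphism *)

Local Notation cG := (completion trace_filter).
Implicit Types f : cG.

(** Convergence to x of the push-forward of f along phi.  It is spelled out
    because the set system of f is meant here, and not the neighbourhoods of f
    as a point of the completion. *)
Definition limit_along f x :=
  forall N, nbhs x N -> completion_filter f (phi @^-1` N).

Let cG_Filter f : Filter (completion_filter f).
Proof. exact: cauchy_filter (completionP f). Qed.
#[local] Existing Instance cG_Filter.

Lemma limit_along_unique f x y : limit_along f x -> limit_along f y -> x = y.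
Proof.
move=> fx fy; apply: H_hausdorff => A B /fx fA /fy fB.
by have [g [Ag Bg]] := completion_ex (filterI fA fB); exists (phi g).
Qed.

(** Cosets of an open subgroup partition H, so the push-forward of f contains
    at most one of them, and the one around its limit is in it. *)
Lemma limit_along_coset f x L g : subgroup L -> compact_open L ->
  limit_along f x -> completion_filter f (right_coset (phi @^-1` L) g) ->
  right_coset L (phi g) = right_coset L x.
Proof.
move=> sL [_ oL] fx fg.
have L1 : nbhs 1 L by apply: open_nbhs_nbhs; split=> //; exact: sL.1.
have [h [/= xh]] := completion_ex (filterI (fx _ (nbhs_right_coset x L1)) fg).
rewrite -(preimage_right_coset phiM) => gh.
by rewrite -(right_coset_eq sL xh) (right_coset_eq sL gh).
Qed.

(** Compactness of a single coset gives a cluster point, and the Cauchy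
    property promotes it to a limit. *)
Lemma limit_along_ex f : exists x, limit_along f x.
Proof.
have pushF : ProperFilter (fmap phi (completion_filter f)).
  split; last exact: fmap_filter.
  by rewrite /fmap /= preimage_set0 => /completion_ex [].
have coset L : subgroup L -> compact_open L -> exists g,
    completion_filter f (phi @^-1` (right_coset L (phi g))).
  move=> sL cL.
  have [g fg] := completion_coset f (trace_filter_preimage sL cL).
  by exists g; rewrite (preimage_right_coset phiM).
have [L0 [sL0 cL0 _]] := van_dantzig H_tdlc (@filterT _ (nbhs (1 : H)) _).
have [g0 fg0] := coset L0 sL0 cL0.
have [x [_ clx]] := (compact_open_right_coset (phi g0) cL0).1 _ pushF fg0.
exists x => N xN; have [L [sL cL LN]] := van_dantzig_coset H_tdlc xN.
have [g fg] := coset L sL cL.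
have L1 : nbhs 1 L by apply: open_nbhs_nbhs; split; [exact: cL.2 | exact: sL.1].
have [y [gy xy]] := clx _ _ fg (nbhs_right_coset x L1).
apply: filterS fg => h gh; apply: LN.
by rewrite -(right_coset_eq sL xy) (right_coset_eq sL gy).
Qed.

Definition completion_limit f : H := projT1 (cid (limit_along_ex f)).

Lemma completion_limitP f : limit_along f (completion_limit f).
Proof. exact: projT2 (cid (limit_along_ex f)). Qed.

Lemma completion_limitE f x : limit_along f x -> completion_limit f = x.
Proof. exact/limit_along_unique/completion_limitP. Qed.

Lemma completion_limit_beta g :
  completion_limit (completion_beta trace_filter g) = phi g.
Proof.
apply: completion_limitE => N gN.
have [L [sL cL LN]] := van_dantzig_coset H_tdlc gN.
exists (phi @^-1` L); first exact: trace_filter_preimage.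
by rewrite -(preimage_right_coset phiM); exact: preimage_subset.
Qed.

Lemma completion_limitM : {morph completion_limit : f f' / f * f'}.
Proof.
move=> f f'; apply: completion_limitE.
move=> N /(@mulg_continuous H (completion_limit f, completion_limit f')).
move=> [[A B] /= [fA fB] sub].
exists (phi @^-1` A), (phi @^-1` B); split; [exact: completion_limitP.. |].
by move=> _ [a Aa [b Bb <-]]; rewrite /preimage /= phiM; exact: (sub (_, _)).
Qed.

(** All Cauchy filters containing a coset of phi^-1(L) have their limit in the
    corresponding coset of L, by [limit_along_coset]. *)
Lemma completion_limit_continuous : continuous completion_limit.
Proof.
move=> f N /(van_dantzig_coset H_tdlc) [L [sL cL LN]].
have SL := trace_filter_preimage sL cL.
have [g fg] := completion_coset f SL.
apply/nbhs_completionP; exists (phi @^-1` L), g; split=> // f' f'g.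
apply: LN; rewrite -(limit_along_coset sL cL (@completion_limitP f) fg).
rewrite (limit_along_coset sL cL (@completion_limitP f') f'g).
exact: right_coset_id.
Qed.

Lemma range_meets_nbhs x N : nbhs x N -> exists g, N (phi g).
Proof.
have [_ _ dphi _] := hphi.
rewrite nbhsE => -[O [oO Ox] ON].
have [y [/ON Ny [g _ gy]]] := dphi O (ex_intro _ x Ox) oO.
by exists g; rewrite gy.
Qed.

(** The candidate for the inverse image of x under the isomorphism. *)
Definition trace_nbhs x : set_system G :=
  [set A | exists2 N, nbhs x N & phi @^-1` N `<=` A].

(** Density enters twice: to find a representative in G of the coset required
    at each V, and to recognise L x as the coset of an element of G. *)
Lemma trace_nbhs_cauchy x : is_cauchy_filter trace_filter (trace_nbhs x).
Proof.
apply: is_cauchyI => [|V [sV [K [cK oK] VK]]|A [N xN NA]].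
- split; first by exists setT => //; exact: filterT.
    move=> A B [N xN NA] [M xM MB]; exists (N `&` M); first exact: filterI.
    by move=> g [/NA Ag /MB Bg].
  by move=> A B AB [N xN NA]; exists N => //; exact: subset_trans AB.
- have K1 : nbhs (1 : H) K.
    apply: open_nbhs_nbhs; split=> //; rewrite -phi1.
    by have := sV.1; rewrite VK.
  have [|C [D [xC xD CDK]]] := @divg_nbhs H K x x; first by rewrite mulgV.
  have [g Dg] := range_meets_nbhs xD; exists g, C => // h Ch.
  by apply/right_cosetP; rewrite VK /preimage /= phiF; exact: CDK.
have [L [sL cL LN]] := van_dantzig_coset H_tdlc xN.
have L1 : nbhs 1 L by apply: open_nbhs_nbhs; split; [exact: cL.2 | exact: sL.1].
have [g Lg] := range_meets_nbhs (nbhs_right_coset x L1).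
exists (phi @^-1` L), g; split; first exact: trace_filter_preimage.
- exists (right_coset L x); first exact: nbhs_right_coset.
  by rewrite -(preimage_right_coset phiM) (right_coset_eq sL Lg).
rewrite -(preimage_right_coset phiM) (right_coset_eq sL Lg).
by apply: subset_trans NA; exact: preimage_subset.
Qed.

Definition completion_of_nbhs x : cG := Completion (trace_nbhs_cauchy x).

Lemma completion_of_nbhsK : cancel completion_of_nbhs completion_limit.
Proof. by move=> x; apply: completion_limitE => N xN; exists N. Qed.

Lemma completion_limitK : cancel completion_limit completion_of_nbhs.
Proof.
move=> f; apply: completion_sub_eq => A [N fN NA].
by apply: filterS NA _; exact: completion_limitP.
Qed.

Lemma completion_of_nbhs_continuous : continuous completion_of_nbhs.
Proof.
move=> x P /nbhs_completionP [V [g [SV [N xN NVg] VP]]].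
apply: filterS (nbhs_interior xN) => y Ny; apply: VP.
by exists N.
Qed.

Lemma completion_limit_iso : top_group_isomorphism completion_limit.
Proof.
split; [exact: completion_limitM | exact: completion_limit_continuous |].
exists completion_of_nbhs; first exact: completion_of_nbhs_continuous.
by split; [exact: completion_limitK | exact: completion_of_nbhsK].
Qed.

(** In the completion, f is the limit of the points beta g along f itself, so a
    continuous psi sends it to a limit of the values phi g = psi (beta g). *)
Lemma continuous_extension_limit (psi : cG -> H) f : continuous psi ->
  phi = psi \o completion_beta trace_filter -> limit_along f (psi f).
Proof.
move=> cpsi phiE N /cpsi /nbhs_completionP [V [g [SV fg VN]]].
apply: filterS fg => h /(right_coset_eq (local_filter_subgroup SV)) gh.
rewrite /preimage /= phiE /=; apply: VN; exists V => //.
by rewrite gh.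
Qed.

End CompactOpenTraces.

Theorem theorem1p3 (G H : topGroupType) (phi : G -> H)
    (hphi : tdlc_completion_map phi) :
  exists S : local_filter G, exists! psi : completion S -> H,
    top_group_isomorphism psi /\ phi = psi \o completion_beta S.
Proof.
exists (trace_filter hphi), (@completion_limit _ _ _ hphi); split.
  split; first exact: completion_limit_iso.
  by apply/funext => g; rewrite /= completion_limit_beta.
move=> psi [[_ cpsi _] phiE]; apply/funext => f.
exact/completion_limitE/continuous_extension_limit.
Qed.
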